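(* Let $\Delta(\mathfrak{e}_6)=\{\alpha_1,\dots,\alpha_6\}$ be the simple system of $\mathfrak{e}_6$ and let $\mathfrak{f}_4\subset\mathfrak{e}_6$ be the symmetric subalgebra, both as described in the context. The standard $\mathfrak{f}_4$-compatible parabolic subalgebras of $\mathfrak{e}_6$ are exactly those $\mathfrak{p}_\Pi$, $\Pi\subseteq\Delta(\mathfrak{e}_6)$, such that (1) either $\{\alpha_2,\alpha_6\}\subseteq\Pi$ or $\{\alpha_2,\alpha_6\}\cap\Pi=\emptyset$; and (2) either $\{\alpha_3,\alpha_5\}\subseteq\Pi$ or $\{\alpha_3,\alpha_5\}\cap\Pi=\emptyset$.
   Context: Let $\mathfrak{h}$ be a Cartan subalgebra of $\mathfrak{g}=\mathfrak{e}_6$ with simple roots $\alpha_1,\dots,\alpha_6$ having Cartan matrix $$\begin{pmatrix}2&0&0&-1&0&0\\0&2&-1&0&0&0\\0&-1&2&-1&0&0\\-1&0&-1&2&-1&0\\0&0&0&-1&2&-1\\0&0&0&0&-1&2\end{pmatrix},$$ positive system $\Phi^+$, and let $H_\alpha$ denote the co-root of $\alpha$. The subalgebra $\mathfrak{f}_4=\mathfrak{g}^\tau$ is the fixed-point algebra of an involutive automorphism $\tau$ of $\mathfrak{e}_6$, embedded so that it has a Cartan subalgebra $\mathfrak{h}_{\mathfrak{f}_4}\subset\mathfrak{h}$ with simple system given by (the restrictions of) $\beta_1=\frac12\alpha_2+\frac12\alpha_6$, $\beta_2=\frac12\alpha_3+\frac12\alpha_5$, $\beta_3=\alpha_4$,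 $\beta_4=\alpha_1$ ($\beta_1,\beta_2$ short, $\beta_3,\beta_4$ long), and $\mathfrak{h}_{\mathfrak{f}_4}$ is spanned over $\mathbb{C}$ by the co-roots $H_{\beta_1}=H_{\alpha_2}+H_{\alpha_6}$, $H_{\beta_2}=H_{\alpha_3}+H_{\alpha_5}$, $H_{\beta_3}=H_{\alpha_4}$, $H_{\beta_4}=H_{\alpha_1}$. For $\Pi\subseteq\Delta(\mathfrak{e}_6)$, the standard parabolic subalgebra is $\mathfrak{p}_\Pi=\mathfrak{h}+\sum_{\alpha\in\Phi^+}\mathfrak{g}_\alpha+\sum_{\alpha\in\mathbb{N}\Pi\cap\Phi^+}\mathfrak{g}_{-\alpha}$, where $\mathfrak{g}_\alpha$ is the root space of $\alpha$ and $\mathbb{N}\Pi$ denotes the non-negative integer combinations of elements of $\Pi$. A semisimple element $H\in\mathfrak{g}$ is hyperbolic if all eigenvalues of $\mathrm{ad}(H)$ on $\mathfrak{g}$ are real; for such $H$, $\mathfrak{p}(H)$ is the sum of the eigenspaces of $\mathrm{ad}(H)$ with eigenvalues $\ge 0$, a parabolic subalgebra of $\mathfrak{g}$. For a reductive subalgebra $\mathfrak{g}'$ of $\mathfrak{g}$, a parabolic subalgebra $\mathfrak{p}$ of $\mathfrak{g}$ is $\mathfrak{g}'$-compatible if there exists $H\in\mathfrak{g}'$, hyperbolic as an element of $\mathfrak{g}$, with $\mathfrak{p}=\mathfrak{p}(H)$. *)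

(* Defs.v *)
From HB Require Import structures.
From mathcomp Require Import all_boot all_order all_algebra.
From mathcomp Require Import boolp classical_sets reals.
From mathcomp Require Import complex.

Set Implicit Arguments.
Unset Strict Implicit.
Unset Printing Implicit Defensive.

Import Order.TTheory GRing.Theory Num.Theory passmx.
Local Open Scope ring_scope.
Local Open Scope classical_set_scope.

HB.mixin Record Lmodule_isLie (K : fieldType) V of GRing.Lmodule K V := {
  lie : V -> V -> V;
  lie_linearl : forall y : V, linear (lie^~ y);
  lie_linearr : forall x : V, linear (lie x);
  lie_alt : forall x : V, lie x x = 0;
  lie_jacobi : forall x y z : V,
    lie x (lie y z) + lie y (lie z x) + lie z (lie x y) = 0
}.

#[short(type="lieAlgType")]
HB.structure Definition LieAlgebra (K : fieldType) :=
  { V of Vector K V & Lmodule_isLie K V }.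

Section LieAlgebras.
Variables (R : realType) (g : lieAlgType R[i]).
Local Notation C := R[i].
Implicit Types (k t I : {vspace g}) (x y H : g) (A : set g).

HB.instance Definition _ x :=
  GRing.isLinear.Build C g g *:%R (@lie _ g x) (@lie_linearr _ g x).

Definition ad x : 'End(g) := linfun (@lie _ g x).

Definition lie_ideal I := forall x y, y \in I -> lie x y \in I.

Definition lie_simple :=
  (exists x y, lie x y != 0) /\
  (forall I, lie_ideal I -> I = 0%VS \/ I = fullv).

Definition lie_abelian k := {in k &, forall x y, lie x y = 0}.

Definition lie_involution (tau : 'End(g)) :=
  [/\ forall x y, tau (lie x y) = lie (tau x) (tau y),
      forall x, tau (tau x) = x
    & tau != \1%VF].

(* Finite sums of elements of [A]: when [A] is a union of subspaces, this is
   the sum of those subspaces, for a possibly infinite family. *)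
Definition sums A : set g :=
  [set x | exists2 s : seq g, (forall y, y \in s -> A y) & x = \sum_(y <- s) y].

(* [k] is the sum of its intersections with the eigenspaces of [ad H]; for
   [H] in a subalgebra [k], the restriction of [ad H] to [k] is diagonalizable. *)
Definition ad_semisimple k H :=
  [set` k] `<=`
  sums (\bigcup_(a in [set: C]) ([set` k] `&` [set` leigenspace (ad H) a])).

Definition hyperbolic H :=
  ad_semisimple fullv H /\
  (forall a : C, leigenvalue (ad H) a -> a \is Num.real).

(* In [R[i]], [0 <= a] says that [a] is a nonnegative real. *)
Definition parabolic_of H : set g :=
  sums (\bigcup_(a in [set a : C | 0 <= a]) [set` leigenspace (ad H) a]).

Definition compatible k (p : set g) :=
  exists H, [/\ H \in k, hyperbolic H & p = parabolic_of H].

(* Cartan subalgebra [t] of a semisimple subalgebra [k]: a maximal abelian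
   subalgebra of [k] all of whose elements are ad-semisimple on [k]. *)
Definition cartan_subalgebra k t :=
  [/\ (t <= k)%VS,
      lie_abelian t,
      forall a : {vspace g}, (t <= a)%VS -> (a <= k)%VS -> lie_abelian a -> a = t
    & forall H, H \in t -> ad_semisimple k H].

Definition dual t := 'Hom(subvs_of t, C^o).

Definition root_space k t (c : dual t) : set g :=
  [set x | x \in k /\ forall H : subvs_of t, lie (vsval H) x = (c H : C) *: x].

Definition is_root k t (c : dual t) :=
  c != 0 /\ exists2 x, root_space k c x & x != 0.

(* Non-negative integer combinations of the [alpha_i] with [i \in P]. *)
Definition ncomb t n (alpha : n.-tuple (dual t)) (P : {set 'I_n}) : set (dual t) :=
  [set c | exists m : 'I_n -> nat, c = \sum_(i in P) tnth alpha i *+ m i].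

Definition pos_root k t n (alpha : n.-tuple (dual t)) : set (dual t) :=
  [set c | is_root k c /\ ncomb alpha [set: 'I_n]%SET c].

Definition simple_system k t n (alpha : n.-tuple (dual t)) :=
  [/\ forall i, is_root k (tnth alpha i),
      basis_of fullv alpha
    & forall c : dual t, is_root k c ->
        pos_root k alpha c \/ pos_root k alpha (- c)].

(* The element of [k_c, k_(-c)] on which [c] takes the value 2. *)
Definition is_coroot k t (c : dual t) H :=
  [/\ H \in t, c (vsproj t H) = 2
    & sums [set z | exists x y,
        [/\ root_space k c x, root_space k (- c) y & z = lie x y]] H].

Definition std_parabolic t n (alpha : n.-tuple (dual t)) (P : {set 'I_n}) : set g :=
  sums ([set` t]
    `|` \bigcup_(c in pos_root fullv alpha) root_space fullv c
    `|` \bigcup_(c in ncomb alpha P `&` pos_root fullv alpha)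
          root_space fullv (- c)).

Definition restrict_dual t t' (c : dual t) : dual t' :=
  (c \o linfun (vsproj t) \o linfun vsval)%VF.

(* The index of the simple root [alpha_k], [1 <= k <= 6]: ordinals are
   0-based. *)
Definition node (k : nat) : 'I_6 := inord k.-1.

Definition e6_cartan_matrix : 'M[int]_6 :=
  \matrix_(i, j) nth 0 (nth [::] [::
    [::  2;  0;  0; -1;  0;  0];
    [::  0;  2; -1;  0;  0;  0];
    [::  0; -1;  2; -1;  0;  0];
    [:: -1;  0; -1;  2; -1;  0];
    [::  0;  0;  0; -1;  2; -1];
    [::  0;  0;  0;  0; -1;  2]] i) j.

(* [g] is simple with Cartan subalgebra [h], simple roots [alpha_i] and
   co-roots [Hc_i] realizing the Cartan matrix of type E_6. *)
Definition e6_data (h : {vspace g}) (alpha : 6.-tuple (dual h))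
    (Hc : 6.-tuple g) :=
  [/\ lie_simple,
      cartan_subalgebra fullv h,
      simple_system fullv alpha,
      forall i, is_coroot fullv (tnth alpha i) (tnth Hc i)
    & forall i j, tnth alpha j (vsproj h (tnth Hc i))
                  = (e6_cartan_matrix i j)%:~R].

Definition f4_coroots (Hc : 6.-tuple g) : 4.-tuple g :=
  [tuple tnth Hc (node 2) + tnth Hc (node 6);
         tnth Hc (node 3) + tnth Hc (node 5);
         tnth Hc (node 4);
         tnth Hc (node 1)].

Definition f4_cartan (Hc : 6.-tuple g) : {vspace g} := <<f4_coroots Hc>>%VS.

Definition f4_simple_roots (h t : {vspace g}) (alpha : 6.-tuple (dual h)) :
    4.-tuple (dual t) :=
  [tuple
     restrict_dual t (2^-1 *: tnth alpha (node 2) + 2^-1 *: tnth alpha (node 6));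
     restrict_dual t (2^-1 *: tnth alpha (node 3) + 2^-1 *: tnth alpha (node 5));
     restrict_dual t (tnth alpha (node 4));
     restrict_dual t (tnth alpha (node 1))].

(* The fixed-point algebra of [tau] is the symmetric subalgebra f_4: it has
   [f4_cartan Hc], contained in [h], as a Cartan subalgebra, with simple roots
   [f4_simple_roots] and co-roots [f4_coroots]. *)
Definition f4_data (h : {vspace g}) (alpha : 6.-tuple (dual h))
    (Hc : 6.-tuple g) (tau : 'End(g)) :=
  let k := fixedSpace tau in
  let t := f4_cartan Hc in
  let beta := f4_simple_roots t alpha in
  [/\ lie_involution tau,
      (t <= h)%VS,
      cartan_subalgebra k t,
      simple_system k beta
    & forall i, is_coroot k (tnth beta i) (tnth (f4_coroots Hc) i)].

End LieAlgebras.

(* Main.v *)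
Require Import Defs.
From HB Require Import structures.
From mathcomp Require Import boolp classical_sets.
From mathcomp Require Import all_boot all_order all_algebra.
From mathcomp Require Import reals complex.
From mathcomp Require Import ssrAC ring.

(** Let [t] be the Cartan subalgebra of [f_4], contained in the Cartan
    subalgebra [h] of [e_6].

    The parabolic [p_Pi] is [p(H)] for every [H] in [h] with [alpha_i(H)] equal
    to 0 for [i] in [Pi] and to 1 otherwise: a root is, up to sign, a
    combination of simple roots with coefficients in the natural numbers, and
    the sign of its value at [H] tells whether simple roots outside [Pi] occur
    in it and with which sign ([hyperbolic_grading], [parabolic_grading]).
    This needs the root space decomposition, obtained by simultaneous
    diagonalization of [ad h] ([weight_decomposition]).

    If [Pi] is stable under the exchange of 2 with 6 and of 3 with 5, then so are
    the prescribed values, hence the coefficients of [H] on the co-roots of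
    [e_6], and [H] lies in [t] ([e6_solution_sym]).  So [p_Pi] is compatible.

    Conversely, let [p_Pi = p(H)] with [H] fixed by [tau].  Then [p_Pi] is
    stable under [tau], and conjugating [H] into [t] can be avoided as follows.
    The element [rho] of [h] at which all simple roots take the value 1 lies in
    [t], so [tau] fixes it; since [h] is the centralizer of [rho]
    ([centralizer_rho]) and the simple roots are the roots with value 1 at [rho]
    ([height1_simple]), [tau] preserves [h] and maps simple roots to simple
    roots.  Let [p], [q] be 2, 6 or 3, 5, in either order: [alpha_p] and
    [alpha_q] agree on [t].  With [omega] in [h] dual to [alpha_p] in the basis
    of simple roots, the element [omega + tau omega] is fixed by [tau], hence in [t] because [t] is maximal
    abelian in [f_4]; comparing the values of [alpha_p] and [alpha_q] there
    shows that [tau] exchanges these two roots ([twist_swap]).  If [q] is in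
    [Pi], then [tau] maps the root space of [-alpha_q], contained in [p_Pi],
    into that of [-alpha_p]; so [p] is in [Pi] ([swap_parabolic]). *)

Set Implicit Arguments.
Unset Strict Implicit.
Unset Printing Implicit Defensive.

Import GRing.Theory Num.Theory passmx.
Local Open Scope ring_scope.

(** * Sums of eigenvectors *)

Section Sums.
Local Open Scope classical_set_scope.
Variables (R : realType) (g : lieAlgType R[i]).
Local Notation C := R[i].
Implicit Types (A B : set g) (W : {vspace g}) (f : 'End(g)) (S : set C).

Lemma sums0 A : sums A 0.
Proof. by exists [::]; rewrite ?big_nil. Qed.

Lemma sumsD A x y : sums A x -> sums A y -> sums A (x + y).
Proof.
move=> [s sA ->] [r rA ->]; exists (s ++ r); last by rewrite big_cat.
by move=> z; rewrite mem_cat => /orP[/sA|/rA].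
Qed.

Lemma sums_mem A x : A x -> sums A x.
Proof.
by move=> Ax; exists [:: x]; rewrite ?big_seq1// => y; rewrite inE => /eqP->.
Qed.

Lemma sums_min A (P : g -> Prop) : P 0 ->
  (forall x y, P x -> P y -> P (x + y)) -> (forall x, A x -> P x) ->
  forall x, sums A x -> P x.
Proof.
by move=> P0 PD AP x [s sA ->]; rewrite big_seq; elim/big_ind: _ => // y /sA/AP.
Qed.

Lemma sums_sub A B : (forall x, A x -> sums B x) -> forall x, sums A x -> sums B x.
Proof. by apply: sums_min; [exact: sums0|exact: sumsD]. Qed.

Lemma leigenspaceP f a x : reflect (f x = a *: x) (x \in leigenspace f a).
Proof.
rewrite memv_ker add_lfunE opp_lfunE scale_lfunE id_lfunE subr_eq0.
exact: eqP.
Qed.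

(** Distinct eigenvalues can be separated inside any stable subspace, by
    induction on their number: applying [f - b0] removes the component of
    eigenvalue [b0] and multiplies the others by nonzero scalars. *)
Lemma eigencomponents_stable f W (l : seq C) (v : C -> g) :
  (forall x, x \in W -> f x \in W) -> uniq l ->
  (forall b, f (v b) = b *: v b) ->
  \sum_(b <- l) v b \in W -> forall b, b \in l -> v b \in W.
Proof.
move=> fW; elim: l v => // b0 l IH v /= /andP[b0l ul] fv; rewrite big_cons => xW.
have vW b : b \in l -> v b \in W.
  move=> bl; have bb0 : b - b0 != 0.
    by rewrite subr_eq0; apply: contraNneq b0l => <-.
  rewrite -(scalerK bb0 (v b)) memvZ //.
  apply: (IH (fun b => (b - b0) *: v b)) => // [c|].
    by rewrite linearZ /= fv !scalerA mulrC.
  suff -> : \sum_(c <- l) (c - b0) *: v c =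
      f (v b0 + \sum_(c <- l) v c) - b0 *: (v b0 + \sum_(c <- l) v c).
    by rewrite memvB ?fW ?memvZ.
  rewrite linearD linear_sum /= fv scalerDr opprD addrACA subrr add0r.
  rewrite scaler_sumr -sumrB; apply: eq_bigr => c _.
  by rewrite fv scalerBl.
move=> b; rewrite inE => /predU1P[->|/vW//].
rewrite -(addrK (\sum_(c <- l) v c) (v b0)) memvB // big_seq.
exact: memv_suml.
Qed.

(** Summands with the same eigenvalue must be merged before
    [eigencomponents_stable] applies: only the total component of each
    eigenvalue is determined by [x]. *)
Lemma sums_eigen_group f S x :
  sums (\bigcup_(a in S) [set` leigenspace f a]) x ->
  exists l (v : C -> g), [/\ uniq l, forall b, b \in l -> S b,
    forall b, f (v b) = b *: v b & x = \sum_(b <- l) v b].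
Proof.
case=> s; elim: s x => [|y s IH] x sA ->.
  by exists [::], (fun=> 0); split=> // [b|]; rewrite ?linear0 ?scaler0 ?big_nil.
have [||l [v [ul lS fv ev]]] := IH (\sum_(z <- s) z).
- by move=> z zs; apply: sA; rewrite inE zs orbT.
- by [].
have [|a Sa /leigenspaceP fy] := sA y; first by rewrite inE eqxx.
rewrite big_cons ev; have [al|al] := boolP (a \in l).
  exists l, (fun b => v b + (b == a)%:R *: y); split=> //.
    move=> b; rewrite linearD linearZ /= fv fy scalerDr; congr (_ + _).
    by case: eqP => [->|]; rewrite ?scale1r // !scale0r scaler0.
  rewrite big_split /= addrC; congr (_ + _).
  rewrite (bigD1_seq a) //= eqxx scale1r big1 ?addr0 // => b /negPf ->.
  by rewrite scale0r.
exists (a :: l), (fun b => if b == a then y else v b); split=> //=.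
- by rewrite al.
- by move=> b; rewrite inE => /predU1P[->|/lS].
- by move=> b; case: eqP => [->|].
rewrite big_cons eqxx; congr (_ + _); rewrite big_seq [RHS]big_seq.
by apply: eq_bigr => b bl; case: eqP => // ba; rewrite -ba bl in al.
Qed.

(** A diagonalizable endomorphism restricts to a diagonalizable one on each
    stable subspace, with no new eigenvalues. *)
Lemma sums_eigen_stable f W S x : (forall y, y \in W -> f y \in W) ->
  x \in W -> sums (\bigcup_(a in S) [set` leigenspace f a]) x ->
  sums (\bigcup_(a in S) ([set` W] `&` [set` leigenspace f a])) x.
Proof.
move=> fW xW /sums_eigen_group[l [v [ul lS fv ev]]]; rewrite ev in xW *.
have vW := eigencomponents_stable fW ul fv xW.
exists (map v l); last by rewrite big_map.
move=> _ /mapP[b bl ->]; exists b; first exact: lS.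
by split; [exact: vW|exact/leigenspaceP].
Qed.

(** The eigenspace of [a] is stable under [f], so [x] is a sum of vectors in its
    intersections with the eigenspaces for elements of [S]; the intersection
    of eigenspaces for distinct eigenvalues is 0. *)
Lemma eigen_in_sums f S a x : f x = a *: x -> x != 0 ->
  sums (\bigcup_(b in S) [set` leigenspace f b]) x -> S a.
Proof.
move=> fx x0 xS; have fW y : y \in leigenspace f a -> f y \in leigenspace f a.
  by move=> /leigenspaceP fy; rewrite fy memvZ //; apply/leigenspaceP.
apply: contrapT => nSa; move/eqP: x0; apply.
have /leigenspaceP xW := fx.
apply: (@sums_min _ (fun z => z = 0)) (sums_eigen_stable fW xW xS) => //.
  by move=> _ _ -> ->; rewrite addr0.
move=> z [b Sb [/= /leigenspaceP fa /leigenspaceP fb]].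
have /eqP : (a - b) *: z = 0 by rewrite scalerBl -fa -fb subrr.
rewrite scaler_eq0 subr_eq0 => /predU1P[ab|/eqP//].
by rewrite ab in nSa.
Qed.

End Sums.

(** * Weight decomposition under a Cartan subalgebra *)

Section Weights.
Local Open Scope classical_set_scope.
Variables (R : realType) (g : lieAlgType R[i]).
Local Notation C := R[i].
Implicit Types (W : {vspace g}) (x y : g).

Lemma adE x y : ad x y = lie x y.
Proof. by rewrite /ad lfunE. Qed.

Lemma lieDr x : {morph lie x : y z / y + z}.
Proof. exact: linearD. Qed.

Lemma lieZr x a y : lie x (a *: y) = a *: lie x y.
Proof. exact: linearZ. Qed.

Lemma lieNr x y : lie x (- y) = - lie x y.
Proof. exact: linearN. Qed.

Lemma liex0 x : lie x 0 = 0.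
Proof. exact: linear0. Qed.

Lemma lieZDl a x y z : lie (a *: x + y) z = a *: lie x z + lie y z.
Proof. exact: lie_linearl. Qed.

Lemma lieDl x y z : lie (x + y) z = lie x z + lie y z.
Proof. by have := lieZDl 1 x y z; rewrite !scale1r. Qed.

Lemma lie0l x : lie 0 x = 0.
Proof. by apply: (addrI (lie 0 x)); rewrite -lieDl !addr0. Qed.

Lemma lieZl a x y : lie (a *: x) y = a *: lie x y.
Proof. by rewrite -[a *: x]addr0 lieZDl lie0l addr0. Qed.

Lemma lieC x y : lie x y = - lie y x.
Proof.
have := lie_alt (x + y); rewrite lieDl !lieDr !lie_alt add0r addr0.
by move/eqP; rewrite addr_eq0 => /eqP.
Qed.

(** The Jacobi identity: [ad x] and [ad y] commute when [x] and [y] do. *)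
Lemma lie_commute x y z : lie x y = 0 -> lie x (lie y z) = lie y (lie x z).
Proof.
move=> xy; have := lie_jacobi x y z.
rewrite [lie z (lie x y)]lieC xy lie0l oppr0 addr0 [lie z x]lieC lieNr.
by move/eqP; rewrite subr_eq0 => /eqP.
Qed.

Variables (h : {vspace g}).
Hypothesis hC : cartan_subalgebra fullv h.

Lemma cartan_lie0 H H' : H \in h -> H' \in h -> lie H H' = 0.
Proof. by case: hC => _ + _ _; apply. Qed.

(** [h] is its own centralizer: adjoining to [h] an element that commutes with
    it gives an abelian subalgebra, and [h] is maximal among these. *)
Lemma cartan_centralizer x : (forall H, H \in h -> lie H x = 0) -> x \in h.
Proof.
move=> hx; case: hC => _ _ hmax _.
rewrite -(hmax (h + <[x]>)%VS (addvSl _ _) (subvf _)).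
  by apply/(subvP (addvSr _ _)); rewrite memv_line.
move=> y z /memv_addP[H Hh [_ /vlineP[a ->] ->]].
move=> /memv_addP[H' H'h [_ /vlineP[b ->] ->]].
rewrite lieDl !lieDr !lieZl !lieZr (cartan_lie0 Hh H'h) (hx _ Hh) lie_alt.
by rewrite [lie x H']lieC (hx _ H'h) oppr0 !scaler0 !addr0.
Qed.

(** Simultaneous diagonalization, one element of [h] at a time: eigenspaces of
    the first element are stable under the others since [h] is abelian. *)
Lemma common_eigenvectors (s : seq g) W : {subset s <= h} ->
  (forall H, H \in h -> forall x, x \in W -> lie H x \in W) ->
  forall x, x \in W ->
  sums [set y | y \in W /\ forall H, H \in s -> exists a, lie H y = a *: y] x.
Proof.
elim: s W => [|H s IH] W sh Wst x xW; first exact: sums_mem.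
have Hh : H \in h by apply: sh; rewrite inE eqxx.
have ssh : {subset s <= h} by move=> z zs; apply: sh; rewrite inE zs orbT.
have xs : sums (\bigcup_(a in [set: C])
    ([set` W] `&` [set` leigenspace (ad H) a])) x.
  apply: sums_eigen_stable => //; first by move=> y yW; rewrite adE Wst.
  case: hC => _ _ _ /(_ _ Hh x (memvf x)).
  by apply: sums_sub => y [a _ [_ ya]]; apply: sums_mem; exists a.
apply: (sums_sub _ xs) => y [a _ [/= yW ya]].
have {IH} := IH (W :&: leigenspace (ad H) a)%VS ssh.
move=> /(_ _ y) []; last 2 first.
- by rewrite memv_cap yW.
- move=> r rP ->; exists r => // z /rP[]; rewrite memv_cap.
  move=> /andP[zW /leigenspaceP]; rewrite adE => za zs; split=> // H'.
  by rewrite inE => /predU1P[->|/zs//]; exists a.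
move=> H' H'h z; rewrite !memv_cap => /andP[zW /leigenspaceP].
rewrite adE => za; rewrite Wst //; apply/leigenspaceP; rewrite adE.
by rewrite (lie_commute _ (cartan_lie0 Hh H'h)) za lieZr.
Qed.

(** The eigenvalue of [H] on a common eigenvector [y] is linear in [H], being
    a linear functional of [lie H y]. *)
Lemma weight_of_eigenvector y : y != 0 ->
  (forall H, H \in vbasis h -> exists a, lie H y = a *: y) ->
  exists c : dual h, root_space fullv c y.
Proof.
move=> y0 yE.
have fy : free [tuple y] by rewrite seq1_free.
pose phi : g -> C := coord [tuple y] ord0.
have phiy : phi y = 1 by rewrite /phi (coord_free ord0 ord0 fy).
pose fc (H : subvs_of h) : C^o := phi (lie (vsval H) y).
have fcL : linear fc.
  by move=> a H H'; rewrite /fc linearP lieZDl /phi linearP.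
pose fcl : {linear subvs_of h -> C^o} :=
  HB.pack fc (GRing.isLinear.Build C (subvs_of h) C^o *:%R fc fcL).
exists (linfun fcl); split; first exact: memvf.
move=> H; rewrite lfunE /= /fc.
have [a ->] : exists a, lie (vsval H) y = a *: y.
  rewrite (coord_vbasis (subvsP H)).
  elim/big_ind: _ => [|u v [a ua] [b vb]|i _].
  - by exists 0; rewrite lie0l scale0r.
  - by exists (a + b); rewrite lieDl ua vb scalerDl.
  - have [a Ha] := yE _ (mem_nth 0 (eq_ind_r (fun n => i < n)%N (ltn_ord i) (size_tuple _))).
    by exists (coord (vbasis h) i (vsval H) * a); rewrite lieZl Ha scalerA.
suff -> : phi (a *: y) = a by [].
by rewrite [LHS]linearZ /= -/(phi y) phiy; exact: mulr1.
Qed.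

(** For [W = fullv] this is the decomposition of [g] into root spaces and [h];
    for an eigenspace of [ad H], [H] in [h], it tells which of them occur. *)
Lemma weight_decomposition W :
  (forall H, H \in h -> forall x, x \in W -> lie H x \in W) ->
  forall x, x \in W ->
  sums [set y | [/\ y \in W, y != 0 & exists c : dual h, root_space fullv c y]] x.
Proof.
move=> Wst x xW; have sh : {subset vbasis h <= h} by move=> ? /vbasis_mem.
apply: (sums_sub _ (common_eigenvectors sh Wst xW)) => y [yW yE].
have [->|y0] := eqVneq y 0; first exact: sums0.
by apply: sums_mem; split => //; apply: weight_of_eigenvector.
Qed.

End Weights.

(** * Parabolic subalgebras defined by gradings *)

Section SimpleSystems.
Local Open Scope classical_set_scope.
Variables (R : realType) (g : lieAlgType R[i]) (h : {vspace g}).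
Variables (n : nat) (alpha : n.-tuple (dual h)).
Local Notation C := R[i].
Hypothesis hC : cartan_subalgebra fullv h.
Hypothesis alphaS : simple_system fullv alpha.
Implicit Types (x y H : g) (c : dual h) (P : {set 'I_n}).

(** Values of a functional on [h], with the argument in the ambient algebra so
    that no membership proof has to be carried along. *)
Definition evals c H : C := c (vsproj h H).

Lemma evalsD c H H' : evals c (H + H') = evals c H + evals c H'.
Proof. by rewrite /evals !linearD. Qed.

Lemma evalsZ c a H : evals c (a *: H) = a * evals c H.
Proof. by rewrite /evals !linearZ. Qed.

Lemma evalsN c H : evals (- c) H = - evals c H.
Proof. by rewrite /evals opp_lfunE. Qed.

Lemma root_spaceP c x :
  root_space fullv c x <-> forall H, H \in h -> lie H x = evals c H *: x.
Proof.
split=> [[_ cx] H Hh|cx]; first by have := cx (vsproj h H); rewrite vsprojK.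
split=> [|H]; first exact: memvf.
by rewrite (cx _ (subvsP H)) /evals vsvalK.
Qed.

Lemma evals_comb P (m : 'I_n -> nat) H :
  evals (\sum_(i in P) tnth alpha i *+ m i) H =
  \sum_(i in P) evals (tnth alpha i) H *+ m i.
Proof.
rewrite /evals sum_lfunE; apply: eq_bigr => i _.
by elim: (m i) => [|k IH]; rewrite ?mulr0n ?zero_lfunE // !mulrS add_lfunE IH.
Qed.

Lemma root_sign c : is_root fullv c -> exists m : 'I_n -> nat,
  let d := \sum_(i in [set: 'I_n]%SET) tnth alpha i *+ m i in
  (c = d /\ pos_root fullv alpha c) \/ (- c = d /\ pos_root fullv alpha (- c)).
Proof.
case: alphaS => _ _ H /H [] cp; move: (cp) => [_ [m em]]; exists m => d.
  by left.
by right.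
Qed.

Lemma lie_eigen_stable H a H' x : H \in h -> H' \in h ->
  x \in leigenspace (ad H) a -> lie H' x \in leigenspace (ad H) a.
Proof.
move=> Hh H'h /leigenspaceP; rewrite adE => xa; apply/leigenspaceP.
by rewrite adE (lie_commute _ (cartan_lie0 hC Hh H'h)) xa lieZr.
Qed.

(** The eigenspace of [ad H] for [a] is stable under [ad h], so it is spanned by
    weight vectors, whose weights take the value [a] at [H]; the weight 0 occurs
    only in [h], which is its own centralizer. *)
Lemma eigen_weights H a x : H \in h -> lie H x = a *: x ->
  sums [set y | y != 0 /\
    exists c, [/\ root_space fullv c y, evals c H = a & y \in h \/ is_root fullv c]] x.
Proof.
move=> Hh xa; have xW : x \in leigenspace (ad H) a.
  by apply/leigenspaceP; rewrite adE.
apply: (sums_sub _ (weight_decomposition hC _ xW)) => [y|]; last first.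
  by move=> H' H'h z; apply: lie_eigen_stable.
move=> [/leigenspaceP ya y0 [c yc]]; apply: sums_mem; split=> //; exists c.
split=> //.
  have /eqP : (evals c H - a) *: y = 0.
    by rewrite scalerBl -(root_spaceP c y).1 // -ya adE subrr.
  by rewrite scaler_eq0 (negPf y0) orbF subr_eq0 => /eqP.
have [c0|c0] := eqVneq c 0; last by right; split => //; exists y.
left; apply: (cartan_centralizer hC) => H' H'h.
by rewrite (root_spaceP c y).1 // c0 /evals zero_lfunE scale0r.
Qed.

Section Grading.
Variables (H : g) (P : {set 'I_n}).
Hypotheses (Hh : H \in h)
  (HP : forall i, evals (tnth alpha i) H = (i \notin P)%:R).

Lemma evals_grading (m : 'I_n -> nat) :
  evals (\sum_(i in [set: 'I_n]%SET) tnth alpha i *+ m i) H =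
  (\sum_(i | i \notin P) m i)%:R.
Proof.
rewrite evals_comb natr_sum big_mkcond [RHS]big_mkcond /=.
apply: eq_bigr => i _; rewrite in_setT HP.
by case: (i \in P); rewrite ?mul0rn.
Qed.

Lemma hyperbolic_grading : hyperbolic H.
Proof.
split; first by case: hC => _ _ _; exact.
move=> a; rewrite /leigenvalue -vpick0; set x := vpick _ => x0.
have /leigenspaceP xa : x \in leigenspace (ad H) a by apply: memv_pick.
rewrite adE in xa.
have := eigen_weights Hh xa; case=> -[|y s]; first by move=> _ /eqP; rewrite big_nil (negPf x0).
move=> /(_ y (mem_head _ _)) [y0 [c [yc <- ch]]] _.
have [c0|c0] := eqVneq c 0; first by rewrite c0 /evals zero_lfunE.
have [|m] := @root_sign c; first by split=> //; exists y.
case=> -[cm _]; first by rewrite cm evals_grading rpred_nat.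
by rewrite -rpredN -evalsN cm evals_grading rpred_nat.
Qed.

(** A negative root has a nonnegative value at [H] only if no simple root outside
    [P] occurs in it: its value is minus the sum of their coefficients. *)
Lemma parabolic_grading : parabolic_of H = std_parabolic alpha P.
Proof.
apply/seteqP; split; apply: sums_sub => x.
  move=> [a /= a0 /leigenspaceP]; rewrite adE => xa.
  apply: (sums_sub _ (eigen_weights Hh xa)) => y [y0 [c [yc cH [yh|cr]]]].
    by apply: sums_mem; left; left.
  apply: sums_mem; have [m [[cm cp]|[cm cp]]] := root_sign cr.
    by left; right; exists c.
  right; exists (- c); last by rewrite opprK.
  split=> //; exists m; rewrite cm big_mkcond [RHS]big_mkcond /=.
  apply: eq_bigr => i _; rewrite in_setT; case: ifPn => // iP.
  move: a0; rewrite -cH -oppr_le0 -evalsN cm evals_grading lern0.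
  by rewrite sum_nat_eq0 => /forall_inP /(_ i iP) /eqP ->.
have pos_eig c : pos_root fullv alpha c -> 0 <= evals c H.
  by move=> [_ [m ->]]; rewrite evals_grading ler0n.
move=> [[xh|[c cp cx]]|[c [[m cm] cp] cx]]; apply: sums_mem.
- exists 0; first by rewrite /=.
  by apply/leigenspaceP; rewrite adE scale0r (cartan_lie0 hC).
- exists (evals c H); first exact: pos_eig.
  by apply/leigenspaceP; rewrite adE (root_spaceP c x).1.
exists (evals (- c) H); last first.
  by apply/leigenspaceP; rewrite adE (root_spaceP (- c) x).1.
rewrite /= evalsN cm evals_comb big1 ?oppr0 // => i iP.
by rewrite HP iP mul0rn.
Qed.

End Grading.

Variable rho : g.
Hypotheses (rhoh : rho \in h) (rho1 : forall i, evals (tnth alpha i) rho = 1).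

Lemma evals_rho (m : 'I_n -> nat) :
  evals (\sum_(i in [set: 'I_n]%SET) tnth alpha i *+ m i) rho = (\sum_i m i)%:R.
Proof.
rewrite (@evals_grading rho set0) => [|i]; last by rewrite inE rho1.
by congr (_%:R); apply: eq_bigl => i; rewrite inE.
Qed.

(** Natural numbers with sum 1 are all 0 except for one 1. *)
Lemma height1_simple c : is_root fullv c -> evals c rho = 1 ->
  exists i, c = tnth alpha i.
Proof.
move=> cr c1; have [m [[cm _]|[cm _]]] := root_sign cr; last first.
  move: (evalsN c rho); rewrite cm evals_rho c1 => /eqP.
  by rewrite -subr_eq0 opprK -(natrD _ _ 1) pnatr_eq0 addn1.
have /eqP : (\sum_i m i)%:R = 1 :> C by rewrite -evals_rho -cm c1.
rewrite pnatr_eq1 => /eqP/eqP/sum_nat_eq1[] i [_ mi mj].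
exists i; rewrite cm (bigD1 i) ?inE //= mi big1 ?addr0 // => j /andP[_ ji].
by rewrite mj // mulr0n.
Qed.

(** [rho] is regular: a root has nonzero height. *)
Lemma centralizer_rho x : lie rho x = 0 -> x \in h.
Proof.
rewrite -(scale0r x) => /(eigen_weights rhoh).
apply: (@sums_min _ _ _ (fun z => is_true (z \in h))).
- exact: mem0v.
- by move=> u v; apply: memvD.
move=> y [y0 [c [yc c0 [//|cr]]]].
have [m] := root_sign cr.
have m0 : \sum_i m i = 0%N -> \sum_(i in [set: 'I_n]%SET) tnth alpha i *+ m i = 0.
  move/eqP; rewrite sum_nat_eq0 => /forallP m0.
  by rewrite big1 // => i _; rewrite (eqP (m0 i)).
have cn0 : c <> 0 by case: cr => /eqP.
case=> [[cm _]|[cm _]]; case: cn0.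
  rewrite cm m0 //; apply/eqP; rewrite -(pnatr_eq0 C) -evals_rho -cm.
  by rewrite c0.
apply: oppr_inj; rewrite oppr0 cm m0 //; apply/eqP.
by rewrite -(pnatr_eq0 C) -evals_rho -cm evalsN c0 oppr0.
Qed.

End SimpleSystems.

(** * Action of an involution on the simple roots *)

Section Involution.
Local Open Scope classical_set_scope.
Variables (R : realType) (g : lieAlgType R[i]) (h : {vspace g}).
Variables (n : nat) (alpha : n.-tuple (dual h)) (tau : 'End(g)).
Local Notation C := R[i].
Hypothesis hC : cartan_subalgebra fullv h.
Hypothesis alphaS : simple_system fullv alpha.
Hypothesis tauI : lie_involution tau.
Variable t : {vspace g}.
Hypothesis tC : cartan_subalgebra (fixedSpace tau) t.
Hypothesis th : (t <= h)%VS.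
Local Notation a_ i := (evals (tnth alpha i)).
Variable rho : g.
Hypotheses (rhot : rho \in t) (rho1 : forall i, a_ i rho = 1).
Implicit Types (x y H : g) (c : dual h) (P : {set 'I_n}).

Lemma tau_lie x y : tau (lie x y) = lie (tau x) (tau y).
Proof. by case: tauI. Qed.

Lemma tauK x : tau (tau x) = x.
Proof. by case: tauI. Qed.

Lemma tau_neq0 x : x != 0 -> tau x != 0.
Proof. by apply: contra_neq => tx0; rewrite -[x]tauK tx0 linear0. Qed.

Lemma tau_t H : H \in t -> tau H = H.
Proof. by case: tC => /subvP tk _ _ _ /tk /fixedSpaceP. Qed.

Lemma rho_h : rho \in h.
Proof. exact: (subvP th). Qed.

(** [h] is the centralizer of [rho], and [tau] fixes [rho]. *)
Lemma tau_h H : H \in h -> tau H \in h.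
Proof.
move=> Hh; apply: (centralizer_rho hC alphaS rho_h rho1).
by rewrite -(tau_t rhot) -tau_lie (cartan_lie0 hC rho_h Hh) linear0.
Qed.

(** The fixed points of [tau] in [h] form an abelian subalgebra of the fixed
    algebra that contains [t], so they are [t] by maximality. *)
Lemma fixed_cartan H : H \in h -> tau H = H -> H \in t.
Proof.
move=> Hh tH; case: tC => tk _ tmax _.
rewrite -(tmax (h :&: fixedSpace tau)%VS); last 1 first.
- by move=> x y /memv_capP[xh _] /memv_capP[yh _]; exact: (cartan_lie0 hC).
- by rewrite memv_cap Hh; apply/fixedSpaceP.
- by rewrite subv_cap th.
- exact: capvSr.
Qed.

(** Composition with [tau].  The projection to [h] only makes it well typed: it
    acts as the identity once [tau] is known to preserve [h]. *)
Definition twist c : dual h := (c \o linfun (vsproj h) \o tau \o linfun vsval)%VF.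

Lemma evals_twist c H : H \in h -> evals (twist c) H = evals c (tau H).
Proof.
by move=> Hh; rewrite /evals /twist !(comp_lfunE, lfunE) /= vsprojK.
Qed.

(** As [tau] is its own inverse, the weight is [c \o tau] itself. *)
Lemma twist_root_space c x : root_space fullv c x ->
  root_space fullv (twist c) (tau x).
Proof.
move=> /root_spaceP cx; apply/root_spaceP => H Hh.
rewrite -[in LHS](tauK H) -tau_lie cx ?tau_h // linearZ /=.
by rewrite evals_twist.
Qed.

(** Height is preserved, since [tau] fixes [rho]. *)
Lemma twist_simple i : exists k, twist (tnth alpha i) = tnth alpha k.
Proof.
apply: (height1_simple alphaS rho1); last first.
  by rewrite evals_twist ?rho_h // tau_t.
split.
  apply/eqP => c0; have := rho1 i; rewrite -(tau_t rhot) -evals_twist ?rho_h //.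
  by rewrite c0 /evals zero_lfunE => /eqP; rewrite eq_sym oner_eq0.
case: alphaS => /(_ i)[_ [x xr x0]] _ _.
by exists (tau x); [exact: twist_root_space|exact: tau_neq0].
Qed.

Variables p q : 'I_n.
Hypotheses (pq : p != q) (apq : forall H, H \in t -> a_ p H = a_ q H).
Variable omega : g.
Hypotheses (omegah : omega \in h) (omegaE : forall i, a_ i omega = (i == p)%:R).

(** [omega + tau omega] is fixed by [tau], hence in [t], where [alpha_p] and
    [alpha_q] agree.  Writing [sigma] for the action on indices, their values
    give 1 + [sigma p = p] = [sigma q = p], so [sigma q = p]. *)
Lemma twist_swap : twist (tnth alpha q) = tnth alpha p.
Proof.
have [k tq] := twist_simple q; have [l tp] := twist_simple p.
rewrite tq; congr (tnth alpha _); apply/eqP.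
have : omega + tau omega \in t.
  apply: fixed_cartan; first by rewrite memvD ?tau_h.
  by rewrite linearD /= tauK addrC.
move/apq; rewrite !evalsD -!evals_twist // tq tp !omegaE eqxx [q == p]eq_sym (negPf pq).
by rewrite -!natrD => /eqP; rewrite eqr_nat; case: (k == p) => //; case: (l == p).
Qed.

(** As [H] is fixed by [tau], so is [p(H)] as a set.  It contains the root space of
    [-alpha_q], hence also its image under [tau], the root space of [-alpha_p].
    For [p] outside [P] the latter would have eigenvalue -1 for [ad omegaP]. *)
Lemma swap_parabolic P omegaP H : omegaP \in h ->
  (forall i, a_ i omegaP = (i \notin P)%:R) ->
  tau H = H -> std_parabolic alpha P = parabolic_of H ->
  (exists2 x, x != 0 & root_space fullv (- tnth alpha q) x) ->
  q \in P -> p \in P.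
Proof.
move=> wh wE tH pE [x x0 xq] qP.
have xp : std_parabolic alpha P x.
  apply: sums_mem; right; exists (tnth alpha q); last exact: xq.
  have qP' (Q : {set 'I_n}) : q \in Q -> ncomb alpha Q (tnth alpha q).
    move=> qQ; exists (fun i => i == q); rewrite (bigD1 q) //= eqxx big1 ?addr0 //.
    by move=> i /andP[_ /negPf ->].
  split; first exact: qP'.
  by split; [case: alphaS => + _ _; exact|apply: qP'; rewrite inE].
have txp : std_parabolic alpha P (tau x).
  rewrite pE in xp *; case: xp => s sA ->; exists (map tau s); last first.
    by rewrite big_map linear_sum.
  move=> _ /mapP[y /sA[a a0 /leigenspaceP ya] ->]; exists a => //.
  by apply/leigenspaceP; rewrite adE -{1}tH -tau_lie -adE ya linearZ.
have txw : lie omegaP (tau x) = - a_ p omegaP *: tau x.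
  have /root_spaceP/(_ omegaP wh) -> := twist_root_space xq.
  by rewrite evals_twist // evalsN -evals_twist // twist_swap.
move: txp; rewrite -(parabolic_grading hC alphaS wh wE) /parabolic_of.
rewrite -adE in txw; move=> /(eigen_in_sums txw (tau_neq0 x0)) /=.
by rewrite wE; case: (p \in P) => //; rewrite oppr_ge0 lern0.
Qed.

End Involution.

(** * Elements of the Cartan subalgebra of type E6 *)

Section E6.
Variables (R : realType) (g : lieAlgType R[i]) (h : {vspace g}).
Variables (alpha : 6.-tuple (dual h)) (Hc : 6.-tuple g).
Local Notation C := R[i].
Hypothesis He6 : e6_data alpha Hc.
Local Notation a_ i := (evals (tnth alpha i)).
Local Notation H_ k := (tnth Hc (node k)).

Lemma node_cases (i : 'I_6) : exists2 k, i = node k & k \in iota 1 6.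
Proof.
exists i.+1; first by rewrite /node inord_val.
by have := ltn_ord i; rewrite mem_iota add1n ltnS.
Qed.

Lemma coroot_h i : tnth Hc i \in h.
Proof. by case: He6 => _ _ _ /(_ i)[]. Qed.

Lemma eq_node j k : (0 < j <= 6)%N -> (0 < k <= 6)%N -> (node j == node k) = (j == k).
Proof.
move: j k => [|j] [|k] //= j6 k6.
by rewrite -(inj_eq val_inj) /= !inordK.
Qed.

Lemma evals_coroot i j :
  evals (tnth alpha j) (tnth Hc i) = (e6_cartan_matrix i j)%:~R.
Proof. by case: He6 => _ _ _ _; exact. Qed.

(** The integers are the entries of three times the inverse of the Cartan matrix,
    which has determinant 3; [u j] is the value wanted for [alpha_j]. *)
Definition e6_coeff (u : nat -> C) (j : nat) : C := 3^-1 * nth 0 [::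
  6 * u 1 + 3 * u 2 +  6 * u 3 +  9 * u 4 +  6 * u 5 + 3 * u 6;
  3 * u 1 + 4 * u 2 +  5 * u 3 +  6 * u 4 +  4 * u 5 + 2 * u 6;
  6 * u 1 + 5 * u 2 + 10 * u 3 + 12 * u 4 +  8 * u 5 + 4 * u 6;
  9 * u 1 + 6 * u 2 + 12 * u 3 + 18 * u 4 + 12 * u 5 + 6 * u 6;
  6 * u 1 + 4 * u 2 +  8 * u 3 + 12 * u 4 + 10 * u 5 + 5 * u 6;
  3 * u 1 + 2 * u 2 +  4 * u 3 +  6 * u 4 +  5 * u 5 + 4 * u 6] j.-1.

Definition e6_solution (u : nat -> C) : g :=
  e6_coeff u 1 *: H_ 1 + e6_coeff u 2 *: H_ 2 + e6_coeff u 3 *: H_ 3 +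
  e6_coeff u 4 *: H_ 4 + e6_coeff u 5 *: H_ 5 + e6_coeff u 6 *: H_ 6.

Lemma e6_solution_h u : e6_solution u \in h.
Proof. by rewrite /e6_solution !memvD ?memvZ ?coroot_h. Qed.

Lemma evals_e6_solution u k : k \in iota 1 6 -> a_ (node k) (e6_solution u) = u k.
Proof.
move=> k6; rewrite /e6_solution !evalsD !evalsZ.
move: k6; rewrite !inE => /or4P[||/eqP->|/or3P[]]; try (move=> /eqP->);
by rewrite !evals_coroot !mxE !inordK // /e6_coeff /=; field.
Qed.

(** The inverse Cartan matrix is invariant under the diagram automorphism, so
    the coefficients of a symmetric [u] are symmetric as well. *)
Lemma e6_solution_sym u : u 2 = u 6 -> u 3 = u 5 -> e6_solution u \in f4_cartan Hc.
Proof.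
move=> u26 u35.
have memH i : tnth (f4_coroots Hc) i \in f4_cartan Hc by rewrite memv_span ?mem_tnth.
have c62 : e6_coeff u 6 = e6_coeff u 2 by rewrite /e6_coeff /= u26 u35; ring.
have c53 : e6_coeff u 5 = e6_coeff u 3 by rewrite /e6_coeff /= u26 u35; ring.
have -> : e6_solution u = e6_coeff u 1 *: H_ 1 + e6_coeff u 2 *: (H_ 2 + H_ 6)
    + e6_coeff u 3 *: (H_ 3 + H_ 5) + e6_coeff u 4 *: H_ 4.
  rewrite /e6_solution c62 c53 !scalerDr.
  by rewrite [LHS](ACl (1*(2*6)*(3*5)*4)).
rewrite !memvD ?memvZ //.
- by have := memH (inord 3); rewrite (tnth_nth 0) /= inordK.
- by have := memH (inord 0); rewrite (tnth_nth 0) /= inordK.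
- by have := memH (inord 1); rewrite (tnth_nth 0) /= inordK.
- by have := memH (inord 2); rewrite (tnth_nth 0) /= inordK.
Qed.

Lemma f4_cartan_sym H : H \in f4_cartan Hc ->
  a_ (node 2) H = a_ (node 6) H /\ a_ (node 3) H = a_ (node 5) H.
Proof.
move=> /coord_span ->; elim/big_ind: _ => [|x y|i _].
- by rewrite /evals !linear0.
- by move=> [e1 e2] [e3 e4]; rewrite !evalsD e1 e2 e3 e4.
rewrite !evalsZ; case: i => [[|[|[|[|i]]]] Hi] //=;
  by rewrite ?evalsD !evals_coroot !mxE !inordK //=; split; ring.
Qed.

(** The co-root is nonzero, and is a sum of brackets with vectors of weight
    [- alpha_q]. *)
Lemma negative_simple_root q :
  exists2 x, x != 0 & root_space fullv (- tnth alpha q) x.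
Proof.
case: He6 => _ _ _ /(_ q)[_ a2 [s sA es]] _.
apply: contrapT => nx.
have H0 : tnth Hc q = 0.
  rewrite es big_seq big1 // => z /sA[x [y [_ yr ->]]].
  have [->|y0] := eqVneq y 0; first by rewrite liex0.
  by case: nx; exists y.
by move: a2; rewrite H0 !linear0 => /eqP; rewrite eq_sym pnatr_eq0.
Qed.

End E6.

Theorem proposition12 (R : realType) (g : lieAlgType R[i])
    (h : {vspace g}) (alpha : 6.-tuple (dual h)) (Hc : 6.-tuple g)
    (tau : 'End(g))
    (He6 : e6_data alpha Hc) (Hf4 : f4_data alpha Hc tau)
    (Pi : {set 'I_6}) :
  compatible (fixedSpace tau) (std_parabolic alpha Pi) <->
  ([set node 2; node 6] \subset Pi \/ [set node 2; node 6] :&: Pi = set0) /\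
  ([set node 3; node 5] \subset Pi \/ [set node 3; node 5] :&: Pi = set0).
Proof.
have [_ hC alphaS _ _] := He6; have [tauI th tC _ _] := Hf4.
have symE p q : ([set p; q] \subset Pi \/ [set p; q] :&: Pi = set0) <->
    (p \in Pi) = (q \in Pi).
  rewrite subUset !sub1set; split=> [[/andP[-> ->] //|/setP e]|pq].
    by have := e p; have := e q; rewrite !inE !eqxx orbT /= => -> ->.
  rewrite -pq andbb; case: (boolP (p \in Pi)) => [|pP]; [by left|right].
  apply/setP => i; rewrite !inE; apply/negP => /andP[/orP[]/eqP->].
    exact/negP.
  by rewrite -pq; exact/negP.
rewrite !symE.
pose u k : R[i] := (node k \notin Pi)%:R.
have uE i : evals (tnth alpha i) (e6_solution Hc u) = (i \notin Pi)%:R.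
  by have [k -> k6] := node_cases i; rewrite (evals_e6_solution He6).
have uh := e6_solution_h He6 u.
split=> [[H [/fixedSpaceP tH _ pE]]|[P26 P35]]; last first.
  exists (e6_solution Hc u); split.
  - case: tC => /subvP + _ _ _; apply; apply: e6_solution_sym.
      by rewrite /u P26.
    by rewrite /u P35.
  - exact: (hyperbolic_grading hC alphaS uh uE).
  - by rewrite (parabolic_grading hC alphaS uh uE).
have rhot := @e6_solution_sym R g Hc (fun=> 1) erefl erefl.
have rho1 i : evals (tnth alpha i) (e6_solution Hc (fun=> 1)) = 1.
  by have [k -> k6] := node_cases i; rewrite (evals_e6_solution He6).
have swap p q : p != q ->
    (forall H, H \in f4_cartan Hc ->
      evals (tnth alpha p) H = evals (tnth alpha q) H) ->
    (q \in Pi) -> (p \in Pi).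
  move=> pq apq.
  pose v k : R[i] := (node k == p)%:R.
  have vE i : evals (tnth alpha i) (e6_solution Hc v) = (i == p)%:R.
    by have [k -> k6] := node_cases i; rewrite (evals_e6_solution He6).
  apply: (swap_parabolic hC alphaS tauI tC th rhot rho1 pq apq
            (e6_solution_h He6 v) vE uh uE tH pE).
  exact: (negative_simple_root He6).
have f4 := f4_cartan_sym He6.
by split; apply/idP/idP; apply: swap; rewrite ?eq_node // => H' /f4[].
Qed.
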